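(* Let $\mathcal{G}$ be a graph equipped with an adapted complex structure $J$. If $v$ and $w$ are odd vertices of $\mathcal{G}$ with $w=Jv$, then $d(v,w)\leq 2$. In particular, they are in the same connected component of $\mathcal{G}$.
   Context: Graphs are finite and simple. A vertex is odd if its degree is odd. The distance $d(v,w)$ is the number of edges in a shortest path between $v$ and $w$, and $+\infty$ if there is no such path. For a graph $\mathcal{G}=(V,E)$ label $V=\{v_1,\dots,v_n\}$ and write $e_{i,j}$ ($i<j$) for the edge joining $v_i$ and $v_j$, if it exists. The Lie algebra $\mathfrak{n}_{\mathcal{G}}$ is the real vector space with basis $V\cup E$ and Lie bracket $[v_i,v_j]=e_{i,j}$ for $i<j$ if $v_i,v_j$ are adjacent, $[v_i,v_j]=0$ if they are not adjacent, and all elements of $E$ central. A complex structure on a real Lie algebra $\mathfrak{g}$ is a linear map $J:\mathfrak{g}\to\mathfrak{g}$ with $J^2=-\mathrm{Id}$ and $[x,y]+J([Jx,y]+[x,Jy])-[Jx,Jy]=0$ for all $x,y\in\mathfrak{g}$. An adapted complex structure on the graph $\mathcal{G}$ is a complex structure $J$ on $\mathfrak{n}_{\mathcal{G}}$ such that for every $x\in V\cup E$ either $Jx\in V\cup E$ or $-Jx\in V\cup E$. *)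

(* Defs.v *)
From HB Require Import structures.
From mathcomp Require Import all_boot all_order all_algebra.
From mathcomp Require Import all_classical all_reals ereal.

Set Implicit Arguments.
Unset Strict Implicit.
Unset Printing Implicit Defensive.

Import Order.TTheory GRing.Theory Num.Theory.

Local Open Scope ring_scope.

(* Finite simple graphs; the order of 'I_n is the labelling v_1, ..., v_n. *)
Record sgraph (n : nat) := SGraph {
  adj :> rel 'I_n;
  adj_sym : symmetric adj;
  adj_irr : irreflexive adj }.

Section Graph.
Variables (n : nat) (G : sgraph n).

Definition degree (v : 'I_n) : nat := #|[set w | G v w]%SET|.

Definition odd_vertex (v : 'I_n) : Prop := odd (degree v).

(* The vertices of a path from v are v :: p, so that size p is its number of
   edges. *)
Definition path_between (v w : 'I_n) (p : seq 'I_n) : Prop :=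
  [/\ path G v p, uniq (v :: p) & last v p = w].

(* The infimum is a minimum if there is a path, and +oo otherwise. *)
Definition dist (R : realType) (v w : 'I_n) : \bar R :=
  ereal_inf [set (size p)%:R%:E | p in path_between v w]%classic.

(* (i, j) with i < j stands for the edge e_{i,j}. *)
Definition edge : Type := {p : 'I_n * 'I_n | (p.1 < p.2)%N && G p.1 p.2}.
HB.instance Definition _ := Finite.on edge.

(* The disjoint union of V and E. *)
Definition vertex_or_edge : Type := ('I_n + edge)%type.
HB.instance Definition _ := Finite.on vertex_or_edge.

End Graph.

HB.mixin Record Lmodule_isLieAlgebra (R : realType) g of GRing.Lmodule R g := {
  lie_bracket : g -> g -> g;
  lie_linearl : forall y, linear (fun x => lie_bracket x y);
  lie_linearr : forall x, linear (lie_bracket x);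
  lie_xx : forall x, lie_bracket x x = 0;
  lie_jacobi : forall x y z,
    lie_bracket x (lie_bracket y z) + lie_bracket y (lie_bracket z x)
      + lie_bracket z (lie_bracket x y) = 0 }.

#[short(type="lieAlgType")]
HB.structure Definition LieAlgebra (R : realType) :=
  {g of GRing.Lmodule R g & Lmodule_isLieAlgebra R g}.

Notation "[ 'lie' x , y ]" := (lie_bracket x y)
  (at level 0, format "[ 'lie'  x ,  y ]") : ring_scope.

Definition complex_structure (R : realType) (g : lieAlgType R)
    (J : {linear g -> g}) : Prop :=
  (forall x, J (J x) = - x) /\
  (forall x y, [lie x, y] + J ([lie J x, y] + [lie x, J y]) - [lie J x, J y]
               = 0).

(* The free vector space on V and E *)
Definition graph_lie (R : realType) (n : nat) (G : sgraph n) : Type :=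
  {ffun vertex_or_edge G -> R^o}.
HB.instance Definition _ (R : realType) (n : nat) (G : sgraph n) :=
  GRing.Lmodule.on (graph_lie R G).

Section GraphLie.
Variables (R : realType) (n : nat) (G : sgraph n).
Local Notation nG := (graph_lie R G).

Definition basis_vec (a : vertex_or_edge G) : nG := [ffun b => (b == a)%:R].

(* e_{i,j} if i < j and v_i, v_j are adjacent, and 0 otherwise *)
Definition edge_vec (i j : 'I_n) : nG :=
  if insub (i, j) is Some e then basis_vec (inr e) else 0.

(* At most one of the two terms is nonzero. *)
Definition basis_bracket (a b : vertex_or_edge G) : nG :=
  match a, b with
  | inl i, inl j => edge_vec i j - edge_vec j i
  | _, _ => 0
  end.

Definition graph_bracket (x y : nG) : nG :=
  \sum_a \sum_b (x a * y b) *: basis_bracket a b.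

Let bracketl (y : nG) : linear (fun x => graph_bracket x y).
Proof.
move=> c x z; rewrite /graph_bracket scaler_sumr -big_split /=.
apply: eq_bigr => a _; rewrite scaler_sumr -big_split /=.
by apply: eq_bigr => b _; rewrite !ffunE mulrDl scalerDl scalerA mulrA.
Qed.

Let bracketr (x : nG) : linear (graph_bracket x).
Proof.
move=> c y z; rewrite /graph_bracket scaler_sumr -big_split /=.
apply: eq_bigr => a _; rewrite scaler_sumr -big_split /=.
apply: eq_bigr => b _; rewrite !ffunE mulrDr scalerDl scalerA.
by rewrite /GRing.scale /= mulrCA.
Qed.

Let basis_bracketC a b : basis_bracket a b = - basis_bracket b a.
Proof. by case: a b => [i|e] [j|f] /=; rewrite ?oppr0 // opprB. Qed.

Let bracketxx (x : nG) : graph_bracket x x = 0.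
Proof.
have bN : graph_bracket x x = - graph_bracket x x.
  rewrite {1}/graph_bracket exchange_big /= /graph_bracket -sumrN.
  apply: eq_bigr => a _; rewrite -sumrN; apply: eq_bigr => b _.
  by rewrite basis_bracketC scalerN mulrC.
apply/ffunP => a; rewrite !ffunE; move/ffunP/(_ a): bN; rewrite !ffunE.
by move/eqP; rewrite -addr_eq0 -mulr2n mulrn_eq0 => /eqP.
Qed.

Let bracket_vertex (x y : nG) i : graph_bracket x y (inl i) = 0.
Proof.
rewrite /graph_bracket sum_ffunE big1 // => a _.
rewrite sum_ffunE big1 // => b _; rewrite ffunE.
have edge0 j k : edge_vec j k (inl i) = 0.
  by rewrite /edge_vec; case: insub => [e|]; rewrite ffunE.
by case: a b => [j|e] [k|f]; rewrite /= !ffunE ?edge0 ?subrr scaler0.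
Qed.

Let bracket_bracket (x y z : nG) : graph_bracket x (graph_bracket y z) = 0.
Proof.
rewrite {1}/graph_bracket big1 // => a _; rewrite big1 // => -[i|e] _.
  by rewrite bracket_vertex mulr0 scale0r.
by case: a => [?|?]; rewrite scaler0.
Qed.

Let bracket_jacobi (x y z : nG) :
  graph_bracket x (graph_bracket y z) + graph_bracket y (graph_bracket z x)
    + graph_bracket z (graph_bracket x y) = 0.
Proof. by rewrite !bracket_bracket !addr0. Qed.

HB.instance Definition _ := Lmodule_isLieAlgebra.Build R nG
  bracketl bracketr bracketxx bracket_jacobi.

Definition adapted_complex_structure (J : {linear nG -> nG}) : Prop :=
  complex_structure J /\
  (forall a, (exists b, J (basis_vec a) = basis_vec b) \/
             (exists b, - J (basis_vec a) = basis_vec b)).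

Definition vertex_vec (v : 'I_n) : nG := basis_vec (inl v).

End GraphLie.

(* Main.v *)
(* If v and w = Jv are neither adjacent nor have a common neighbour, then the
   integrability condition for v and a neighbour u of v reads
   [v, u] + J[v, Ju] = [w, Ju]. It forces Ju to be, up to sign, a neighbour of
   v: otherwise [v, u] = [w, Ju], so that w would be an end of the edge vu.
   Hence J induces an involution on the neighbours of v, without fixed points
   as J^2 = -1, and the degree of v is even. *)
Require Import Defs.
From HB Require Import structures.
From mathcomp Require Import all_boot all_order all_algebra.
From mathcomp Require Import all_classical all_reals ereal.

Set Implicit Arguments.
Unset Strict Implicit.
Unset Printing Implicit Defensive.

Import Order.TTheory GRing.Theory Num.Theory.

Local Open Scope ring_scope.

(** Induction on the cardinality: removing the pair [x], [f x] preserves its parity, and the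
    remaining set is still stable under [f]. *)
Lemma odd_card_fixfree_involution (T : finType) (A : {set T}) (f : T -> T) :
  {in A, forall x, [/\ f x \in A, f (f x) = x & f x != x]} -> odd #|A| = false.
Proof.
have [m] := ubnP #|A|; elim: m A => // m IHm A leAm fA.
have [->|[x Ax]] := set_0Vmem A; first by rewrite cards0.
have [Afx ffx nfx] := fA _ Ax.
have Afx' : f x \in A :\ x by rewrite !inE nfx.
rewrite (cardsD1 x) Ax (cardsD1 (f x)) Afx' /= negbK.
apply: IHm => [|y].
  by move: leAm; rewrite (cardsD1 x) Ax (cardsD1 (f x)) Afx' ltnS => /ltnW.
rewrite !inE => /and3P[nyfx nyx Ay]; have [Afy ffy nfy] := fA _ Ay.
split=> //; rewrite Afy andbT; apply/andP; split.
  by apply: contra nyx => /eqP eqf; rewrite -ffy eqf ffx.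
by apply: contra nyfx => /eqP <-; rewrite ffy.
Qed.

Section GraphLieBracket.
Variables (R : realType) (n : nat) (G : sgraph n).
Implicit Types (i j : 'I_n) (a b : vertex_or_edge G) (e : edge G).

Lemma lie_basis a b :
  [lie basis_vec R a, basis_vec R b] = basis_bracket R a b.
Proof.
rewrite /lie_bracket /= /graph_bracket (bigD1 a) //= (bigD1 b) //=.
rewrite !ffunE !eqxx mulr1 scale1r.
rewrite [X in _ + X + _]big1 ?addr0 => [|c /negPf nc]; last first.
  by rewrite !ffunE nc mulr0 scale0r.
rewrite big1 ?addr0 // => c /negPf nc; rewrite big1 // => d _.
by rewrite !ffunE nc mul0r scale0r.
Qed.

Lemma edge_vecE i j e : edge_vec R G i j (inr e) = (val e == (i, j))%:R.
Proof.
rewrite /edge_vec; case: insubP => [e' _ <-|nij]; first by rewrite ffunE.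
by rewrite ffunE; case: eqP => // eij; case/negP: nij; rewrite -eij (valP e).
Qed.

Lemma lie_vertexE i j e : [lie vertex_vec R G i, vertex_vec R G j] (inr e) =
  (val e == (i, j))%:R - (val e == (j, i))%:R.
Proof. by rewrite lie_basis !ffunE !edge_vecE. Qed.

(** Lets the ends of an edge be read off a nonzero coordinate of a bracket. *)
Lemma lie_vertex_neq0 i j e :
  [lie vertex_vec R G i, vertex_vec R G j] (inr e) != 0 ->
  val e = (i, j) \/ val e = (j, i).
Proof.
rewrite lie_vertexE; case: (val e =P (i, j)) => [|_]; first by left.
by case: (val e =P (j, i)) => [|_]; [right | rewrite subrr eqxx].
Qed.

Lemma lie_adj i j : G i j ->
  exists e, [lie vertex_vec R G i, vertex_vec R G j] (inr e) != 0.
Proof.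
wlog ltij : i j / (i < j)%N => [wlogij Gij|Gij].
  have [ltij|ltji|/val_inj eqij] := ltngtP i j; first exact: wlogij.
    have [||e] := wlogij j i; rewrite // 1?adj_sym // => e0; exists e.
    by rewrite lie_vertexE -opprB oppr_eq0 -lie_vertexE.
  by rewrite eqij adj_irr in Gij.
have ije : ((i, j).1 < (i, j).2)%N && G (i, j).1 (i, j).2 by rewrite /= ltij.
exists (Sub (i, j) ije : edge G); rewrite lie_vertexE /= eqxx xpair_eqE.
(* Since [i < j], the pairs [(i, j)] and [(j, i)] differ, so the two terms cannot cancel. *)
by rewrite -val_eqE /= (ltn_eqF ltij) subr0 oner_eq0.
Qed.

Lemma lie_nadj i j :
  ~~ G i j -> [lie vertex_vec R G i, vertex_vec R G j] = 0.
Proof.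
move=> nGij; rewrite lie_basis /= /edge_vec !insubF ?subrr //=.
  by rewrite adj_sym (negPf nGij) andbF.
by rewrite (negPf nGij) andbF.
Qed.

Lemma lie_edge a e : [lie basis_vec R a, basis_vec R (inr e)] = 0.
Proof. by rewrite lie_basis; case: a. Qed.

Lemma lie_scaler (g : lieAlgType R) (c : R) (x y : g) :
  [lie x, c *: y] = c *: [lie x, y].
Proof.
have lie0 : [lie x, 0] = 0.
  (* Coefficient -1 turns linearity at 0 into [x, 0] = - [x, 0] + [x, 0]. *)
  by have /eqP := lie_linearr x (-1) 0 0; rewrite !scaleN1r !addNr => /eqP.
by have := lie_linearr x c y 0; rewrite !addr0 lie0 addr0.
Qed.

Variable J : {linear graph_lie R G -> graph_lie R G}.

(** Packs the two possible signs into one scalar [c], which avoids sign cases later. *)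
Lemma adaptedP a : adapted_complex_structure J ->
  exists b (c : R), c ^+ 2 = 1 /\ J (basis_vec R a) = c *: basis_vec R b.
Proof.
case=> _ /(_ a)[] [b Jab]; exists b; first by exists 1; rewrite expr1n scale1r.
by exists (-1); rewrite sqrrN expr1n scaleN1r -Jab opprK.
Qed.

Lemma basis_vec_neq0 a : basis_vec R a != 0.
Proof.
apply/eqP => /ffunP/(_ a) /eqP; rewrite !ffunE eqxx.
by rewrite (negPf (oner_neq0 _)).
Qed.

(** A real eigenvalue would satisfy c^2 + 1 = 0. *)
Lemma complex_structure_no_eigenvector a (c : R) :
  complex_structure J -> J (basis_vec R a) <> c *: basis_vec R a.
Proof.
case=> JJ _ Jc; have := JJ (basis_vec R a).
rewrite Jc linearZ /= Jc scalerA => /eqP.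
rewrite -addr_eq0 -[X in _ + X]scale1r -scalerDl scaler_eq0.
rewrite (negPf (basis_vec_neq0 a)) orbF.
by rewrite gt_eqF // ltr_wpDl // -expr2 sqr_ge0.
Qed.

Lemma adapted_neighbor (v w u : 'I_n) :
  adapted_complex_structure J -> vertex_vec R G w = J (vertex_vec R G v) ->
  ~~ G v w -> G v u -> ~~ G w u ->
  exists u' (c : R),
    [/\ c ^+ 2 = 1, J (vertex_vec R G u) = c *: vertex_vec R G u' & G v u'].
Proof.
move=> hJ hw nGvw Gvu nGwu; have [[JJ intJ] _] := hJ.
have [b [c [c2 Jub]]] := adaptedP (inl u) hJ.
have [e e0] := lie_adj Gvu.
have /eqP := intJ (vertex_vec R G v) (vertex_vec R G u).
rewrite -hw (lie_nadj nGwu) add0r Jub !lie_scaler.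
case: b Jub => [u'|f] Jub; last first.
  (* Keeps lie_edge from being unified with [v, u], which does not terminate. *)
  set vu := (X in X + _ - _).
  rewrite !lie_edge !scaler0 linear0 addr0 subr0 => /eqP vu0.
  by rewrite -/vu vu0 ffunE eqxx in e0.
have [Gvu' _|nGvu'] := boolP (G v u'); first by exists u', c.
rewrite (lie_nadj nGvu') scaler0 linear0 addr0 subr_eq0 => /eqP vuE.
(* Now [v, u] = c [w, u'], so the edge [e] joins [w] and [u'] as well as [v] and [u]. *)
move: (e0); rewrite vuE ffunE mulf_eq0 negb_or.
move=> /andP[_ /lie_vertex_neq0 ewu'].
have wvu : w = v \/ w = u.
  by case: ewu' (lie_vertex_neq0 e0) => -> [] [] ? ?; subst; auto.
case: wvu => [eqwv|eqwu]; last by rewrite eqwu Gvu in nGvw.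
case: (@complex_structure_no_eigenvector (inl v) 1 (proj1 hJ)).
by rewrite scale1r -[LHS]hw eqwv.
Qed.

Lemma adapted_dist2 (v w : 'I_n) :
  adapted_complex_structure J -> odd_vertex G v ->
  vertex_vec R G w = J (vertex_vec R G v) ->
  G v w \/ exists2 u, G v u & G u w.
Proof.
move=> hJ odd_v hw; have [|nGvw] := boolP (G v w); first by left.
have [/existsP[u /andP[]]|/existsPn common] :=
  boolP [exists u, G v u && G u w]; first by right; exists u.
(* [f u] is the vertex u' with Ju = u' or Ju = -u'. The default is never reached on neighbours of
   [v], where such a vertex exists. *)
pose f u := odflt u [pick u' | J (vertex_vec R G u) (inl u') != 0].
have fE u u' (c : R) : c ^+ 2 = 1 ->
    J (vertex_vec R G u) = c *: vertex_vec R G u' -> f u = u'.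
  move=> c2 Ju; rewrite /f; case: pickP => [x|/(_ u')] /=.
    rewrite Ju !ffunE.
    by case: (inl x =P inl u') => [[]|_] //; rewrite scaler0 eqxx.
  rewrite Ju !ffunE eqxx -[_ *: _]/(c * 1) mulr1 => /negbFE/eqP c0.
  by move/eqP: c2; rewrite c0 expr0n eq_sym oner_eq0.
have [[JJ _] _] := hJ.
suff : odd (degree G v) = false by rewrite odd_v.
apply: (@odd_card_fixfree_involution _ _ f) => u; rewrite inE => Gvu.
have nGwu : ~~ G w u by have := common u; rewrite Gvu adj_sym.
have [u' [c [c2 Ju Gvu']]] := adapted_neighbor hJ hw nGvw Gvu nGwu.
have fu := fE _ _ _ c2 Ju; rewrite fu inE; split=> //; last first.
  apply/eqP => equ; rewrite equ in Ju.
  exact: complex_structure_no_eigenvector (proj1 hJ) Ju.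
(* As c^2 = 1, Ju = c u' gives u' = c Ju, hence Ju' = -c u. *)
apply: (fE _ _ (- c)); first by rewrite sqrrN.
have -> : vertex_vec R G u' = c *: J (vertex_vec R G u).
  by rewrite Ju scalerA -expr2 c2 scale1r.
by rewrite linearZ /= JJ scalerN scaleNr.
Qed.

End GraphLieBracket.

Lemma dist_le (R : realType) n (G : sgraph n) v w p :
  path_between G v w p -> (dist G R v w <= (size p)%:R%:E)%E.
Proof. by move=> vwp; apply: ereal_inf_lbound; exists p. Qed.

Theorem corollary4p11 (R : realType) (n : nat) (G : sgraph n)
    (J : {linear graph_lie R G -> graph_lie R G})
    (hJ : adapted_complex_structure J) (v w : 'I_n)
    (hv : odd_vertex G v) (hw : odd_vertex G w)
    (hvw : vertex_vec R G w = J (vertex_vec R G v)) :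
  (dist G R v w <= 2%:E)%E /\ connect G v w.
Proof.
have neq_adj x y : G x y -> x != y.
  by apply: contraTneq => ->; rewrite adj_irr.
(* A path must not repeat vertices, so [v] and [w] have to be distinct; otherwise Jv = v. *)
have nvw : v != w.
  apply/eqP => eqvw.
  apply: (@complex_structure_no_eigenvector _ _ _ J (inl v) 1 (proj1 hJ)).
  by rewrite scale1r -[LHS]hvw eqvw.
have [Gvw|[u Gvu Guw]] := adapted_dist2 hJ hv hvw.
  split; last exact: connect1.
  apply: (@le_trans _ _ 1%:E); last by rewrite lee_fin ler1n.
  by apply: (@dist_le _ _ _ _ _ [:: w]); split; rewrite //= ?Gvw // inE nvw.
split; last exact: connect_trans (connect1 Gvu) (connect1 Guw).
apply: (@dist_le _ _ _ _ _ [:: u; w]); split; rewrite //= ?Gvu ?Guw //.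
by rewrite !inE negb_or nvw !neq_adj.
Qed.
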